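(* Let $(\mathcal{X}_1,\mathcal{X}_2,p(y_2|x_1)p(y_3|x_1,x_2,y_2),\mathcal{Y}_2,\mathcal{Y}_3)$ be a discrete memoryless noncausal relay channel with capacity $C_\infty$. Then \[ C_{\infty} \geq \max \min\{I(X_1;U,Y_3),\; I(X_1,U;Y_3)-I(U;Y_2|X_1)\}, \] where the maximum is over all pmfs $p(x_1)p(u|y_2)$ (with $U$ taking values in a finite set) and all functions $x_2(u,y_2)$, and the mutual informations are evaluated under the joint distribution $p(x_1)p(y_2|x_1)p(u|y_2)\mathbf{1}\{x_2=x_2(u,y_2)\}p(y_3|x_1,x_2,y_2)$.
   Context: A discrete memoryless (DM) noncausal relay channel consists of finite alphabets $\mathcal{X}_1,\mathcal{X}_2,\mathcal{Y}_2,\mathcal{Y}_3$ and conditional pmfs $p(y_2|x_1)$ and $p(y_3|x_1,x_2,y_2)$; the sender inputs $X_1$, the relay observes $Y_2$ and inputs $X_2$, the receiver observes $Y_3$. It is memoryless: $p(y_{2i}|x_1^i,y_2^{i-1},m)=p(y_{2i}|x_{1i})$ and $p(y_{3i}|x_1^i,x_2^i,y_2^i,y_3^{i-1},m)=p(y_{3i}|x_{1i},x_{2i},y_{2i})$. A $(2^{nR},n)$ code consists of a message set $[1:2^{nR}]$, an encoder assigning a codeword $x_1^n(m)$ to each message $m$, a relay encoder assigning a symbol $x_{2i}(y_2^n)$ for each $i\in[1:n]$ as a function of the entire received sequence $y_2^n$ (noncausal, i.e., unlimited lookahead), and a decoder assigning an estimate $\hat m(y_3^n)$ or an error. The message $M$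 is uniform over $[1:2^{nR}]$, the error probability is $P_e^{(n)}=\mathbb{P}\{\hat M\neq M\}$, a rate $R$ is achievable if there is a sequence of $(2^{nR},n)$ codes with $P_e^{(n)}\to 0$, and the capacity $C_\infty$ is the supremum of achievable rates. *)

(* Defs.v *)
From HB Require Import structures.
From mathcomp Require Import all_boot all_order all_algebra.
From mathcomp Require Import all_classical all_reals all_analysis.
Set Implicit Arguments. Unset Strict Implicit. Unset Printing Implicit Defensive.
Import Order.TTheory GRing.Theory Num.Theory.
Import numFieldNormedType.Exports.
Local Open Scope classical_set_scope.
Local Open Scope ring_scope.

Section Info.
Variable R : realType.

(* logarithm in base 2 (rates are in bits, 2^{nR} messages) *)
Definition log2 (x : R) : R := ln x / ln 2.

Definition is_pmf (T : finType) (p : T -> R) : Prop :=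
  (forall t, 0 <= p t) /\ \sum_(t : T) p t = 1.

Definition is_channel (A B : finType) (W : A -> B -> R) : Prop :=
  forall a, is_pmf (W a).

Definition pushpmf (T A : finType) (P : T -> R) (f : T -> A) (a : A) : R :=
  \sum_(t : T | f t == a) P t.

Definition entropy (T A : finType) (P : T -> R) (f : T -> A) : R :=
  - \sum_(a : A) (let q := pushpmf P f a in if q == 0 then 0 else q * log2 q).

Definition cond_mutinfo (T A B C : finType) (P : T -> R)
    (f : T -> A) (g : T -> B) (h : T -> C) : R :=
  entropy P (fun t => (f t, h t)) + entropy P (fun t => (g t, h t))
  - entropy P (fun t => (f t, g t, h t)) - entropy P h.

Definition mutinfo (T A B : finType) (P : T -> R) (f : T -> A) (g : T -> B) : R :=
  entropy P f + entropy P g - entropy P (fun t => (f t, g t)).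

End Info.

Section Relay.
Variables (R : realType) (X1 X2 Y2 Y3 : finType).
Variables (W2 : X1 -> Y2 -> R) (W3 : X1 -> X2 -> Y2 -> Y3 -> R).

Record nc_code (M n : nat) := NCCode {
  nc_enc : 'I_M -> {ffun 'I_n -> X1};
  nc_relay : 'I_n -> {ffun 'I_n -> Y2} -> X2;
  nc_dec : {ffun 'I_n -> Y3} -> option 'I_M      (* m-hat(y3^n), None = error *)
}.

Definition nc_err (M n : nat) (c : nc_code M n) : R :=
  M%:R^-1 * \sum_(m : 'I_M) \sum_(y2 : {ffun 'I_n -> Y2})
     \sum_(y3 : {ffun 'I_n -> Y3})
       (\prod_(i : 'I_n)
          (W2 (nc_enc c m i) (y2 i) *
           W3 (nc_enc c m i) (nc_relay c i y2) (y2 i) (y3 i)))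
       * (if nc_dec c y3 == Some m then 0 else 1).

Definition nmsg (r : R) (n : nat) : nat := `| Num.ceil (2 `^ (n%:R * r)) |%N.

Definition nc_achievable (r : R) : Prop :=
  exists c : forall n, nc_code (nmsg r n) n,
    (fun n => nc_err (c n)) @ \oo --> (0 : R).

Definition nc_capacity : \bar R :=
  ereal_sup [set (r%:E) | r in nc_achievable].

Definition relay_joint (U : finType) (px1 : X1 -> R) (pu : Y2 -> U -> R)
    (fx2 : U -> Y2 -> X2) (t : X1 * U * Y2 * X2 * Y3) : R :=
  let: (x1, u, y2, x2, y3) := t in
  px1 x1 * W2 x1 y2 * pu y2 u * (if x2 == fx2 u y2 then 1 else 0)
  * W3 x1 x2 y2 y3.

End Relay.

(* Main.v *)
Require Import Defs.
From HB Require Import structures.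
From mathcomp Require Import all_boot all_order all_algebra.
From mathcomp Require Import all_classical all_reals all_analysis.
From mathcomp Require Import ring lra.
Set Implicit Arguments. Unset Strict Implicit. Unset Printing Implicit Defensive.
Import Order.TTheory GRing.Theory Num.Theory.
Import numFieldNormedType.Exports.
Local Open Scope ring_scope.

(** Random coding with hybrid coding at the relay. Draw codewords x1^n(m) from
    p(x1) and u^n(l), l = 1..K, from p(u). The relay would like to choose l with
    probability proportional to p(u^n(l)|y2^n)/p(u^n(l)); once K exceeds
    2^(n I(U;Y2)) the average of these ratios over l is at least 1/2 with high
    probability. Then the expected error is at most twice the error under the
    measure where u^n(l) is drawn from p(u|y2) and every other codeword is
    independent of the channel, so the dependence of l on the codebook disappears.
    A threshold decoder on the information densities then fails with vanishing
    probability when R < I(X1;U,Y3) and R + log K / n < I(X1,U;Y3) + I(X1;U).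
    Since U - Y2 - X1 is Markov, I(U;Y2) - I(X1;U) = I(U;Y2|X1). *)

(** * Product distributions *)

Section ProductPmf.
Variables (R : realType) (I T : finType).
Implicit Types (p : T -> R).

Definition prodpmf p (t : {ffun I -> T}) : R := \prod_i p (t i).

Lemma sum_prod_ffun (F : I -> T -> R) :
  \sum_(t : {ffun I -> T}) \prod_i F i (t i) = \prod_i \sum_a F i a.
Proof. by rewrite bigA_distr_bigA. Qed.

Lemma prodpmf_ge0 p t : is_pmf p -> 0 <= prodpmf p t.
Proof. by case=> p0 _; apply: prodr_ge0. Qed.

Lemma prodpmf_is_pmf p : is_pmf p -> is_pmf (prodpmf p).
Proof.
move=> pp; split=> [t|]; first exact: prodpmf_ge0.
by case: pp => _ p1; rewrite (sum_prod_ffun (fun=> p)) big1.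
Qed.

(** Expanding [g] over the values at [i] and [j] turns each term into a product whose factors carry
    indicators at these two coordinates. Sum and product can then be exchanged, and every other
    coordinate sums to 1. *)
Lemma prodpmf_marg2 p (i j : I) (g : T -> T -> R) : is_pmf p -> i != j ->
  \sum_(t : {ffun I -> T}) prodpmf p t * g (t i) (t j) = \sum_a \sum_b p a * p b * g a b.
Proof.
move=> [_ p1] ij.
pose F a b k c : R := p c *
  (if k == i then (c == a)%:R else if k == j then (c == b)%:R else 1).
transitivity (\sum_(t : {ffun I -> T}) \sum_a \sum_b g a b * \prod_k F a b k (t k)).
  apply: eq_bigr => t _.
  rewrite (bigD1 (t i)) //= (bigD1 (t j)) //= [X in _ + X + _]big1; last first.
    move=> b btj; rewrite (bigD1 j) //= /F eq_sym (negbTE ij) eqxx eq_sym.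
    by rewrite (negbTE btj) mulr0 mul0r mulr0.
  rewrite [X in _ + X]big1; last first.
    move=> a ati; apply: big1 => b _; rewrite (bigD1 i) //= /F eqxx eq_sym.
    by rewrite (negbTE ati) mulr0 mul0r mulr0.
  rewrite !addr0 mulrC; congr (_ * _); apply: eq_bigr => k _; rewrite /F.
  case: (eqVneq k i) => [->|_]; first by rewrite eqxx mulr1.
  by case: (eqVneq k j) => [->|_]; rewrite ?eqxx mulr1.
rewrite exchange_big; apply: eq_bigr => a _.
rewrite exchange_big; apply: eq_bigr => b _.
rewrite -mulr_sumr (sum_prod_ffun (F a b)) mulrC; congr (_ * _).
rewrite (bigD1 i) //= (bigD1 j) 1?eq_sym //= [X in _ * (_ * X)]big1; last first.
  move=> k /andP[/negbTE ki /negbTE kj]; rewrite /F ki kj.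
  by under eq_bigr do rewrite mulr1.
have S a' : \sum_c p c * (c == a')%:R = p a'.
  rewrite (bigD1 a') //= eqxx mulr1 big1 ?addr0 // => c /negbTE->.
  by rewrite mulr0.
by rewrite mulr1 /F eqxx [j == i]eq_sym (negbTE ij) eqxx !S.
Qed.

Lemma prodpmf_marg1 p (i : I) (g : T -> R) : is_pmf p ->
  \sum_(t : {ffun I -> T}) prodpmf p t * g (t i) = \sum_a p a * g a.
Proof.
move=> [_ p1].
pose F a k c : R := p c * (if k == i then (c == a)%:R else 1).
transitivity (\sum_(t : {ffun I -> T}) \sum_a g a * \prod_k F a k (t k)).
  apply: eq_bigr => t _.
  rewrite (bigD1 (t i)) //= [X in _ + X]big1; last first.
    move=> a ati; rewrite (bigD1 i) //= /F eqxx eq_sym.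
    by rewrite (negbTE ati) mulr0 mul0r mulr0.
  rewrite addr0 mulrC; congr (_ * _); apply: eq_bigr => k _; rewrite /F.
  by case: (eqVneq k i) => [->|_]; rewrite ?eqxx mulr1.
rewrite exchange_big; apply: eq_bigr => a _.
rewrite -mulr_sumr (sum_prod_ffun (F a)) mulrC; congr (_ * _).
rewrite (bigD1 i) //= [X in _ * X]big1; last first.
  by move=> k /negbTE ki; rewrite /F ki; under eq_bigr do rewrite mulr1.
rewrite mulr1 /F eqxx (bigD1 a) //= eqxx mulr1 big1 ?addr0 // => c /negbTE->.
by rewrite mulr0.
Qed.

(** After centring [f], independence kills the off-diagonal terms of the squared sum, and each
    diagonal term is a variance, at most the second moment. *)
Lemma prodpmf_variance p (f : T -> R) : is_pmf p ->
  \sum_(t : {ffun I -> T}) prodpmf p t * (\sum_i f (t i) - #|I|%:R * \sum_a p a * f a) ^+ 2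
    <= #|I|%:R * \sum_a p a * f a ^+ 2.
Proof.
move=> pp; have [p0 p1] := pp.
set mu := \sum_a p a * f a; pose g a := f a - mu.
have g0 : \sum_a p a * g a = 0.
  rewrite /g; under eq_bigr do rewrite mulrBr.
  by rewrite sumrB -mulr_suml p1 mul1r subrr.
have g2 : \sum_a p a * g a ^+ 2 <= \sum_a p a * f a ^+ 2.
  rewrite -subr_ge0 -sumrB.
  rewrite (_ : \sum_a _ = mu ^+ 2); first exact: sqr_ge0.
  transitivity (\sum_a (2 * mu * (p a * f a) - mu ^+ 2 * p a)).
    by apply: eq_bigr => a _; rewrite /g; ring.
  rewrite sumrB -!mulr_sumr p1 -/mu; ring.
have E (t : {ffun I -> T}) : \sum_i f (t i) - #|I|%:R * mu = \sum_i g (t i) :> R.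
  by rewrite /g sumrB sumr_const mulr_natl.
under eq_bigr do rewrite E expr2 mulr_suml mulr_sumr.
rewrite exchange_big /= mulr_natl -sumr_const; apply: ler_sum => i _.
under eq_bigr do rewrite mulr_sumr mulr_sumr.
rewrite exchange_big /= (bigD1 i) //= [X in _ + X]big1; last first.
  move=> j ji; rewrite (prodpmf_marg2 (fun a b => g a * g b) pp) 1?eq_sym //.
  apply: big1 => a _; transitivity (p a * g a * \sum_b p b * g b).
    by rewrite mulr_sumr; apply: eq_bigr => b _; ring.
  by rewrite g0 mulr0.
by apply: le_trans g2; rewrite addr0 (prodpmf_marg1 i (fun a => g a ^+ 2) pp).
Qed.

End ProductPmf.

(* Chebyshev's O(1/n) rate, multiplied out so that [n = 0] is not special. *)
Lemma aep (R : realType) (T : finType) (p F G : T -> R) (E d : R) :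
    is_pmf p -> (forall t, p t != 0 -> 0 < F t /\ 0 < G t) ->
    E = \sum_t p t * (ln (F t) - ln (G t)) -> 0 < d ->
  exists C, forall n : nat,
    n%:R * \sum_(t : {ffun 'I_n -> T}) prodpmf p t *
      (\prod_i F (t i) < expR (n%:R * (E - d)) * \prod_i G (t i))%R%:R <= C.
Proof.
move=> pp FG EE d0; have [p0 p1] := pp.
pose f t := ln (F t) - ln (G t).
exists ((\sum_a p a * f a ^+ 2) / d ^+ 2) => n.
have [->|n0] := eqVneq n 0%N.
  rewrite mul0r; apply: divr_ge0; last exact: sqr_ge0.
  by apply: sumr_ge0 => a _; rewrite mulr_ge0 ?sqr_ge0.
have np : 0 < n%:R :> R by rewrite ltr0n lt0n.
rewrite ler_pdivlMr ?exprn_gt0 // -(ler_pM2l np).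
have := prodpmf_variance 'I_n f pp; rewrite card_ord -EE; apply: le_trans.
rewrite mulrA mulrAC -mulrA.
rewrite [X in X <= _](_ : _ = (\sum_(t : {ffun 'I_n -> T}) prodpmf p t *
  (\prod_i F (t i) < expR (n%:R * (E - d)) * \prod_i G (t i))%R%:R) * (n%:R * d) ^+ 2);
  last by ring.
rewrite mulr_suml; apply: ler_sum => t _.
rewrite -mulrA; have [z|nz] := eqVneq (prodpmf p t) 0; first by rewrite z !mul0r.
apply: ler_wpM2l; first exact: prodpmf_ge0.
(* Chebyshev, term by term: on this event the sum of the log-ratios lies more than [n * d] below its
   mean, so [(n * d) ^+ 2] is at most the squared deviation. Taking logarithms is legitimate because
   [t] lies in the support. *)
case: (boolP (\prod_i F (t i) < _)) => [lt|_]; last by rewrite mul0r sqr_ge0.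
have pos i : 0 < F (t i) /\ 0 < G (t i).
  by apply: FG; apply: contraNneq nz => z; rewrite /prodpmf (bigD1 i) //= z mul0r.
have lnE (H : T -> R) : (forall i, 0 < H (t i)) ->
    \prod_i H (t i) = expR (\sum_i ln (H (t i))).
  by move=> H0; rewrite expR_sum; apply: eq_bigr => i _; rewrite lnK ?posrE.
move: lt; rewrite !lnE; [|by move=> i; case: (pos i)..].
rewrite -expRD ltr_expR => lt.
have {}lt : n%:R * d < - (\sum_i f (t i) - n%:R * E).
  by rewrite /f sumrB; lra.
rewrite mul1r -[leRHS]sqrrN ler_sqr ?nnegrE; first exact: ltW.
- by rewrite mulr_ge0 // ltW.
- by rewrite ltW // (le_lt_trans _ lt) // mulr_ge0 // ltW.
Qed.

(** * One-shot coding bound *)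

Section OneShot.
Variables (R : realType) (X U Y Z : finType).
Variables (px : X -> R) (W : X -> Y -> R) (pu : Y -> U -> R).
Variable V : X -> Y -> U -> Z -> R.

Definition joint x u y z : R := px x * W x y * pu y u * V x y u z.
Definition joint_xuz x u z : R := \sum_y joint x u y z.
Definition joint_uz u z : R := \sum_x joint_xuz x u z.
Definition marg_u u : R := \sum_z joint_uz u z.
Definition marg_z z : R := \sum_u joint_uz u z.
Definition marg_y y : R := \sum_x px x * W x y.

Hypotheses (px_pmf : is_pmf px) (W_chan : is_channel W).
Hypotheses (pu_chan : is_channel pu) (V_chan : forall x y, is_channel (V x y)).

Lemma joint_ge0 x u y z : 0 <= joint x u y z.
Proof.
case: px_pmf => px0 _; rewrite /joint !mulr_ge0 //.
- by case: (W_chan x).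
- by case: (pu_chan y).
- by case: (V_chan x y u).
Qed.

Lemma joint_xuz_ge0 x u z : 0 <= joint_xuz x u z.
Proof. by apply: sumr_ge0 => y _; exact: joint_ge0. Qed.

Lemma joint_uz_ge0 u z : 0 <= joint_uz u z.
Proof. by apply: sumr_ge0 => x _; exact: joint_xuz_ge0. Qed.

Lemma marg_u_ge0 u : 0 <= marg_u u.
Proof. by apply: sumr_ge0 => z _; exact: joint_uz_ge0. Qed.

Lemma marg_y_ge0 y : 0 <= marg_y y.
Proof.
apply: sumr_ge0 => x _; case: px_pmf => px0 _.
by apply: mulr_ge0 => //; case: (W_chan x).
Qed.

Lemma joint_sumz x u y : \sum_z joint x u y z = px x * W x y * pu y u.
Proof. by rewrite -mulr_sumr; case: (V_chan x y u) => _ ->; rewrite mulr1. Qed.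

Lemma marg_uE u : marg_u u = \sum_y marg_y y * pu y u.
Proof.
rewrite /marg_u /joint_uz exchange_big /=.
under eq_bigr => x _ do rewrite /joint_xuz exchange_big /=.
rewrite exchange_big /=; apply: eq_bigr => y _.
by rewrite mulr_suml; apply: eq_bigr => x _; rewrite joint_sumz.
Qed.

Lemma sum_marg_y : \sum_y marg_y y = 1.
Proof.
rewrite /marg_y exchange_big /=; case: px_pmf => _ <-.
by apply: eq_bigr => x _; rewrite -mulr_sumr; case: (W_chan x) => _ ->; rewrite mulr1.
Qed.

Lemma marg_u_pmf : is_pmf marg_u.
Proof.
split; first exact: marg_u_ge0.
under eq_bigr do rewrite marg_uE.
rewrite exchange_big /= -sum_marg_y; apply: eq_bigr => y _.
by rewrite -mulr_sumr; case: (pu_chan y) => _ ->; rewrite mulr1.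
Qed.

Lemma sum_joint_xuz : \sum_x \sum_u \sum_z joint_xuz x u z = 1.
Proof.
case: marg_u_pmf => _ <-; rewrite exchange_big /=; apply: eq_bigr => u _.
by rewrite exchange_big.
Qed.

(* The likelihood ratio p(u|y)/p(u), read as [0] when [marg_u u = 0]. *)
Definition lratio u y : R := pu y u / marg_u u.

Lemma lratio_ge0 u y : 0 <= lratio u y.
Proof. by rewrite divr_ge0 ?marg_u_ge0 //; case: (pu_chan y). Qed.

Lemma marg_u_lratio_le u y : marg_u u * lratio u y <= pu y u.
Proof.
rewrite /lratio; have [->|u0] := eqVneq (marg_u u) 0.
  by rewrite mul0r; case: (pu_chan y).
by rewrite mulrC divfK.
Qed.

Lemma marg_u0 u y : marg_u u = 0 -> marg_y y * pu y u = 0.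
Proof.
rewrite marg_uE => /eqP; rewrite psumr_eq0 => [/allP/(_ y)|i _].
  by rewrite mem_index_enum => /(_ isT)/eqP.
by rewrite mulr_ge0 ?marg_y_ge0 //; case: (pu_chan i).
Qed.

(** * Covering: the likelihood ratios of a random codebook rarely average below 1/2 *)

Section Covering.
Variables (K : nat) (T : R).
Hypotheses (K_gt0 : (0 < K)%N) (T_ge0 : 0 <= T).

(** The normalising constant of the relay's ideal random choice of an index. Its mean over the
    codebook is 1 whenever [marg_y y] is positive. *)
Definition total_weight (c : {ffun 'I_K -> U}) y : R :=
  K%:R^-1 * \sum_l lratio (c l) y.

(** Ratios above [T] are discarded so that the second moment is bounded and Chebyshev applies to the
    average over the codebook. *)
Let trunc u y : R := if pu y u <= T * marg_u u then lratio u y else 0.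
Let tmean y := \sum_u marg_u u * trunc u y.

Let trunc_ge0 u y : 0 <= trunc u y.
Proof. by rewrite /trunc; case: ifP => // _; exact: lratio_ge0. Qed.

Let trunc_le u y : trunc u y <= T.
Proof.
rewrite /trunc; case: ifP => // le; rewrite /lratio.
have [->|u0] := eqVneq (marg_u u) 0; first by rewrite invr0 mulr0.
by rewrite ler_pdivrMr // lt_def u0 marg_u_ge0.
Qed.

Let tmean_ge0 y : 0 <= tmean y.
Proof. by apply: sumr_ge0 => u _; rewrite mulr_ge0 ?marg_u_ge0. Qed.

Let tmean_le1 y : tmean y <= 1.
Proof.
case: (pu_chan y) => p0 <-; apply: ler_sum => u _.
apply: le_trans (marg_u_lratio_le u y).
rewrite ler_wpM2l ?marg_u_ge0 // /trunc; case: ifP => // _; exact: lratio_ge0.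
Qed.

Let tmean2_le y : \sum_u marg_u u * trunc u y ^+ 2 <= T.
Proof.
apply: (@le_trans _ _ (T * tmean y)); last by rewrite ler_piMr.
rewrite mulr_sumr; apply: ler_sum => u _.
by rewrite [leRHS]mulrCA expr2 ler_wpM2l ?marg_u_ge0 // ler_wpM2r.
Qed.

(** A light codebook means that either truncation lost much of the mean or the truncated average [s]
    fell far below [tmean y]. The constant 8 is large enough for [8 * (s - t) ^+ 2 + 8 * (1 - t)] to
    be at least 1 whenever [s < 1/2] and [t <= 1]. *)
Let light_le (c : {ffun 'I_K -> U}) y :
  (total_weight c y < 2^-1)%R%:R <=
  8 * K%:R^-2 * (\sum_l trunc (c l) y - K%:R * tmean y) ^+ 2 + 8 * (1 - tmean y).
Proof.
have K0 : 0 < K%:R :> R by rewrite ltr0n.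
have m1 : 0 <= 1 - tmean y by rewrite subr_ge0.
case: (boolP (total_weight c y < _)) => [lt|_]; last first.
  apply: addr_ge0; last exact: mulr_ge0.
  apply: mulr_ge0; last exact: sqr_ge0.
  by apply: mulr_ge0 => //; rewrite invr_ge0 sqr_ge0.
set s := K%:R^-1 * \sum_l trunc (c l) y.
have slt : s < 2^-1.
  apply: le_lt_trans lt; rewrite /total_weight /s ler_pM2l ?invr_gt0 //.
  apply: ler_sum => l _; rewrite /trunc; case: ifP => // _; exact: lratio_ge0.
rewrite [X in X + _](_ : _ = 8 * (s - tmean y) ^+ 2); last first.
  by rewrite /s; field; rewrite gt_eqF.
have := tmean_le1 y; have := tmean_ge0 y.
move: (tmean y) slt => t; move: s => {}s slt t0 t1 /=.
have := sqr_ge0 (2 * t - 1 - s); nra.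
Qed.

(** The variance of the truncated average is at most [T / K]. Weighted by [marg_y y], the lost mean
    [1 - tmean y] is the probability that p(u|y) exceeds [T] p(u). *)
Lemma covering :
  \sum_y marg_y y * \sum_c prodpmf marg_u c * (total_weight c y < 2^-1)%R%:R
  <= 8 * T / K%:R +
     8 * \sum_x \sum_u \sum_y \sum_z joint x u y z * (T * marg_u u < pu y u)%R%:R.
Proof.
have K0 : 0 < K%:R :> R by rewrite ltr0n.
have step y : \sum_c prodpmf marg_u c * (total_weight c y < 2^-1)%R%:R
    <= 8 * T / K%:R + 8 * (1 - tmean y).
  apply: (@le_trans _ _ (\sum_(c : {ffun 'I_K -> U}) (8 * K%:R^-2 * (prodpmf marg_u c *
     (\sum_l trunc (c l) y - K%:R * tmean y) ^+ 2) +
     8 * (1 - tmean y) * prodpmf marg_u c))).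
    apply: ler_sum => c _.
    apply: le_trans (ler_wpM2l (prodpmf_ge0 c marg_u_pmf) (light_le c y)) _.
    by rewrite le_eqVlt; apply/orP; left; apply/eqP; ring.
  rewrite big_split /= -!mulr_sumr (proj2 (prodpmf_is_pmf _ marg_u_pmf)) mulr1.
  rewrite lerD2r.
  have := prodpmf_variance 'I_K (trunc^~ y) marg_u_pmf; rewrite card_ord => H.
  have {}H := le_trans H (ler_wpM2l (ltW K0) (tmean2_le y)).
  apply: le_trans (ler_wpM2l _ H) _; first by rewrite mulr_ge0 // invr_ge0 sqr_ge0.
  by rewrite le_eqVlt; apply/orP; left; apply/eqP; field; rewrite gt_eqF.
apply: le_trans (ler_sum _ (fun y _ => ler_wpM2l (marg_y_ge0 y) (step y))) _.
under eq_bigr do rewrite mulrDr.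
rewrite big_split /= -mulr_suml sum_marg_y mul1r lerD2l.
under eq_bigr do rewrite mulrCA.
rewrite -mulr_sumr ler_pM2l //.
have -> : \sum_x \sum_u \sum_y \sum_z joint x u y z * (T * marg_u u < pu y u)%R%:R =
    \sum_y \sum_u marg_y y * pu y u * (T * marg_u u < pu y u)%R%:R.
  rewrite exchange_big [RHS]exchange_big /=; apply: eq_bigr => u _.
  rewrite exchange_big /=; apply: eq_bigr => y _.
  rewrite !mulr_suml; apply: eq_bigr => x _.
  by rewrite -mulr_suml joint_sumz.
apply: ler_sum => y _; rewrite -[X in X - _](proj2 (pu_chan y)) -sumrB mulr_sumr.
apply: ler_sum => u _; rewrite /trunc ltNge; case: ifP => _ /=; last first.
  by rewrite mulr0 subr0 mulr1.
(* Where [marg_u u = 0] the ratio is 0 by the convention on division, but such pairs have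
   probability 0, so no mass is lost. *)
rewrite mulr0 /lratio; have [u0|u0] := eqVneq (marg_u u) 0.
  by rewrite u0 mul0r subr0 (marg_u0 _ u0).
by rewrite [marg_u u * _]mulrC divfK // subrr mulr0.
Qed.

End Covering.

(** * Packing: the threshold decoder under random codebooks *)

Section Packing.
Variables (M K : nat) (a b : R).
Hypotheses (a_gt0 : 0 < a) (b_gt0 : 0 < b).

Local Notation encoders := {ffun 'I_M -> X}.
Local Notation codebooks := {ffun 'I_K -> U}.

Definition avg (phi : encoders -> codebooks -> R) : R :=
  \sum_e prodpmf px e * \sum_c prodpmf marg_u c * phi e c.

Lemma ler_avg phi psi : (forall e c, phi e c <= psi e c) -> avg phi <= avg psi.
Proof.
move=> le; apply: ler_sum => e _; rewrite ler_wpM2l ?prodpmf_ge0 //.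
by apply: ler_sum => c _; rewrite ler_wpM2l // prodpmf_ge0 //; exact: marg_u_pmf.
Qed.

Lemma avgD phi psi : avg (fun e c => phi e c + psi e c) = avg phi + avg psi.
Proof.
rewrite /avg -big_split; apply: eq_bigr => e _ /=; rewrite -mulrDr -big_split.
by congr (_ * _); apply: eq_bigr => c _; rewrite mulrDr.
Qed.

Lemma avgZ k phi : avg (fun e c => k * phi e c) = k * avg phi.
Proof.
rewrite /avg mulr_sumr; apply: eq_bigr => e _; rewrite mulrCA; congr (_ * _).
by rewrite mulr_sumr; apply: eq_bigr => c _; rewrite mulrCA.
Qed.

Lemma avg_sum (J : finType) (P : pred J) (phi : J -> encoders -> codebooks -> R) :
  avg (fun e c => \sum_(j | P j) phi j e c) = \sum_(j | P j) avg (phi j).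
Proof.
rewrite /avg exchange_big; apply: eq_bigr => e _ /=; rewrite -mulr_sumr; congr (_ * _).
by rewrite exchange_big; apply: eq_bigr => c _ /=; rewrite mulr_sumr.
Qed.

(** Derandomisation. If [phi] exceeded [B] everywhere, the average of [phi - B] would be positive,
    since some encoder and some codebook carry positive weight. *)
Lemma avg_exists phi B : avg phi <= B -> exists e c, phi e c <= B.
Proof.
move=> le; apply: contrapT => none.
have lt e c : B < phi e c.
  by rewrite ltNge; apply/negP => le'; apply: none; exists e, c.
have [e0 e1] := prodpmf_is_pmf 'I_M px_pmf.
have [c0 c1] := prodpmf_is_pmf 'I_K marg_u_pmf.
have : avg (fun e c => phi e c - B) <= 0.
  rewrite /avg; under eq_bigr => e _.
    under eq_bigr do rewrite mulrBr.
    rewrite sumrB -mulr_suml c1 mul1r mulrBr; over.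
  by rewrite sumrB -mulr_suml e1 mul1r subr_le0.
suff : 0 < avg (fun e c => phi e c - B) by move=> h1 /(lt_le_trans h1); rewrite ltxx.
have ex (J : finType) (p : J -> R) : \sum_j p j = 1 -> exists j, p j != 0.
  move=> p1; apply: contrapT => no; have := oner_neq0 R; rewrite -p1 big1 ?eqxx // => j _.
  by apply/eqP; apply: contrapT => /negP pj; apply: no; exists j.
have [e ne] := ex _ _ e1; have [c nc] := ex _ _ c1.
have in0 e' : 0 <= \sum_c prodpmf marg_u c * (phi e' c - B).
  by apply: sumr_ge0 => c' _; rewrite mulr_ge0 // subr_ge0 ltW.
rewrite /avg (bigD1 e) //= ltr_pwDl //; last first.
  by apply: sumr_ge0 => e' _; rewrite mulr_ge0.
apply: mulr_gt0; first by rewrite lt_def ne e0.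
rewrite (bigD1 c) //= ltr_pwDl //; last first.
  by apply: sumr_ge0 => c' _; rewrite mulr_ge0 // subr_ge0 ltW.
by apply: mulr_gt0; rewrite ?subr_gt0 // lt_def nc c0.
Qed.

Lemma avg_marg11 m l (phi : X -> U -> R) :
  avg (fun e c => phi (e m) (c l)) = \sum_x px x * \sum_u marg_u u * phi x u.
Proof.
rewrite /avg -(prodpmf_marg1 m _ px_pmf); apply: eq_bigr => e _; congr (_ * _).
by rewrite (prodpmf_marg1 l (phi (e m)) marg_u_pmf).
Qed.

Lemma avg_marg21 m m' l (phi : X -> X -> U -> R) : m != m' ->
  avg (fun e c => phi (e m) (e m') (c l)) =
  \sum_x \sum_x' px x * px x' * \sum_u marg_u u * phi x x' u.
Proof.
move=> mm'.
rewrite /avg -(prodpmf_marg2 _ px_pmf mm'); apply: eq_bigr => e _; congr (_ * _).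
by rewrite (prodpmf_marg1 l (phi (e m) (e m')) marg_u_pmf).
Qed.

Lemma avg_marg22 m m' l l' (phi : X -> X -> U -> U -> R) : m != m' -> l != l' ->
  avg (fun e c => phi (e m) (e m') (c l) (c l')) =
  \sum_x \sum_x' px x * px x' * \sum_u \sum_u' marg_u u * marg_u u' * phi x x' u u'.
Proof.
move=> mm' ll'.
rewrite /avg -(prodpmf_marg2 _ px_pmf mm'); apply: eq_bigr => e _; congr (_ * _).
by rewrite (prodpmf_marg2 (phi (e m) (e m')) marg_u_pmf ll').
Qed.

(** A threshold test on two information densities, multiplied out to avoid dividing by zero. The
    first condition guards against a wrong message with the true index, the second against a wrong
    message with a wrong index. *)
Definition good x u z : bool :=
  (a * (px x * joint_uz u z) <= joint_xuz x u z) &&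
  (b * (px x * marg_u u * marg_z z) <= joint_xuz x u z).

(** The relay's index is decoded non-uniquely: a wrong index next to the right message is no
    error. *)
Definition decoder (e : encoders) (c : codebooks) z : option 'I_M :=
  [pick m | [exists l, good (e m) (c l) z]].

(* Off [marg_u u = 0], the conditional probability of [z] given [x] and [u], times
   the likelihood ratio p(u|x)/p(u). *)
Definition tilted x u z : R := \sum_y lratio u y * W x y * V x y u z.

Lemma tilted_ge0 x u z : 0 <= tilted x u z.
Proof.
apply: sumr_ge0 => y _; apply: mulr_ge0; last by case: (V_chan x y u).
by rewrite mulr_ge0 ?lratio_ge0 //; case: (W_chan x).
Qed.

(** Change of measure: p(u) times the likelihood ratio is p(u|y), except that it drops to 0 where
    [marg_u u = 0]. *)
Lemma tilted_le x u z : px x * marg_u u * tilted x u z <= joint_xuz x u z.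
Proof.
rewrite mulr_sumr; apply: ler_sum => y _; rewrite /joint.
rewrite [leLHS](_ : _ = px x * W x y * V x y u z * (marg_u u * lratio u y)); last by ring.
rewrite [leRHS](_ : _ = px x * W x y * V x y u z * pu y u); last by ring.
apply: ler_wpM2l (marg_u_lratio_le u y); case: px_pmf => px0 _.
by rewrite !mulr_ge0 //; [case: (W_chan x)|case: (V_chan x y u)].
Qed.

(** Union bound over the causes of an error: the true pair fails the test, or a wrong message passes
    it with index [l], or with another index. *)
Lemma decoder_neq e c z m l :
  (decoder e c z != Some m)%:R <= (~~ good (e m) (c l) z)%:R
    + \sum_(m' | m' != m) (good (e m') (c l) z)%:R
    + \sum_(m' | m' != m) \sum_(l' | l' != l) (good (e m') (c l') z)%:R :> R.
Proof.
have s0 (J : finType) (P : pred J) (F : J -> bool) : 0 <= \sum_(j | P j) (F j)%:R :> R.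
  by apply: sumr_ge0.
have s2 : 0 <= \sum_(m' | m' != m) \sum_(l' | l' != l) (good (e m') (c l') z)%:R :> R.
  by apply: sumr_ge0 => m' _; apply: s0.
case: (boolP (good (e m) (c l) z)) => [gd|_] /=; last first.
  by case: (_ != _); rewrite -?addrA ?lerDl ?addr_ge0.
rewrite add0r; case: (boolP [exists m', (m' != m) && [exists l', good (e m') (c l') z]]).
  case/existsP => m' /andP[mm' /existsP[l' gd']].
  apply: (@le_trans _ _ 1); first by case: (_ != _).
  have [E|ll'] := eqVneq l' l.
    by rewrite (bigD1 m') //= -E gd' -addrA lerDl addr_ge0 // E.
  rewrite addrC (bigD1 m') //= (bigD1 l') //= gd' -!addrA lerDl.
  by rewrite addr_ge0 // addr_ge0 // sumr_ge0.
rewrite negb_exists => /forallP no.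
rewrite (_ : decoder e c z = Some m) ?eqxx ?addr_ge0 // /decoder.
case: pickP => [m' gm'|/(_ m) /= /negbT/existsPn/(_ l)]; last by rewrite gd.
by have := no m'; rewrite gm' andbT negbK => /eqP->.
Qed.

Definition miss : R := \sum_x \sum_u \sum_z joint_xuz x u z * (~~ good x u z)%:R.

(** On the event [good], the measure [F] is at most [joint_xuz / k], and [joint_xuz] has total mass
    1. *)
Lemma sum_good_le (k : R) (F : X -> U -> Z -> R) : 0 < k ->
    (forall x u z, 0 <= F x u z) ->
    (forall x u z, good x u z -> k * F x u z <= joint_xuz x u z) ->
  \sum_x \sum_u \sum_z F x u z * (good x u z)%:R <= k^-1.
Proof.
move=> k0 F0 Fle; rewrite -[leRHS]mulr1 -[X in _ <= _ * X]sum_joint_xuz mulr_sumr.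
apply: ler_sum => x _; rewrite mulr_sumr; apply: ler_sum => u _.
rewrite mulr_sumr; apply: ler_sum => z _.
case: (boolP (good x u z)) => [/Fle le|_].
  by rewrite mulr1 -ler_pdivrMl ?invr_gt0 // invrK.
by rewrite mulr0 mulr_ge0 ?joint_xuz_ge0 // invr_ge0 ltW.
Qed.

Lemma sum_tilted_x (g : Z -> R) u : (forall z, 0 <= g z) ->
  \sum_x px x * (marg_u u * \sum_z tilted x u z * g z) <= \sum_z joint_uz u z * g z.
Proof.
move=> g0; apply: (@le_trans _ _ (\sum_x \sum_z joint_xuz x u z * g z)).
  apply: ler_sum => x _; rewrite !mulr_sumr; apply: ler_sum => z _.
  by rewrite !mulrA ler_wpM2r // tilted_le.
by rewrite exchange_big /=; under eq_bigr do rewrite -mulr_suml.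
Qed.

(** Weighted by [tilted], the true pair and the output are dominated by their joint law, while all
    other codewords are independent of the output. A wrong message thus sees [px * joint_uz] with
    the true index and [px * marg_u * marg_z] with a wrong one, so each union term costs at most
    [1 / a] or [1 / b]. *)
Lemma packing m l :
  avg (fun e c => \sum_z tilted (e m) (c l) z * (decoder e c z != Some m)%:R)
  <= miss + M.-1%:R / a + M.-1%:R * K.-1%:R / b.
Proof.
have [px0 px1] := px_pmf; have [mu0 _] := marg_u_pmf.
pose t1 (e : encoders) (c : codebooks) : R := \sum_z tilted (e m) (c l) z * (~~ good (e m) (c l) z)%:R.
pose t2 m' (e : encoders) (c : codebooks) : R := \sum_z tilted (e m) (c l) z * (good (e m') (c l) z)%:R.
pose t3 m' l' (e : encoders) (c : codebooks) : R := \sum_z tilted (e m) (c l) z * (good (e m') (c l') z)%:R.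
apply: (@le_trans _ _ (avg (fun e c => t1 e c + \sum_(m' | m' != m) t2 m' e c
     + \sum_(m' | m' != m) \sum_(l' | l' != l) t3 m' l' e c))).
  apply: ler_avg => e c; rewrite /t1 /t2 /t3.
  under [X in _ <= _ + X]eq_bigr do rewrite exchange_big.
  rewrite [X in _ + X + _]exchange_big [X in _ + _ + X]exchange_big -!big_split /=.
  apply: ler_sum => z _; rewrite -mulr_sumr.
  under [X in _ <= _ + X]eq_bigr do rewrite -mulr_sumr.
  rewrite -mulr_sumr -!mulrDr ler_wpM2l ?tilted_ge0 //; exact: decoder_neq.
rewrite !avgD; apply: lerD; first apply: lerD.
- rewrite [avg t1](avg_marg11 m l (fun x u => \sum_z tilted x u z * (~~ good x u z)%:R)).
  apply: ler_sum => x _; rewrite mulr_sumr; apply: ler_sum => u _.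
  rewrite !mulr_sumr; apply: ler_sum => z _; rewrite !mulrA.
  by rewrite ler_wpM2r // tilted_le.
- have -> : M.-1%:R / a = \sum_(m' : 'I_M | m' != m) a^-1.
    rewrite sumr_const mulr_natl; congr (_ *+ _).
    by have := cardC1 m; rewrite card_ord => <-; apply: eq_card.
  rewrite avg_sum; apply: ler_sum => m' mm'.
  rewrite [avg (t2 m')](avg_marg21 l
    (fun x x' u => \sum_z tilted x u z * (good x' u z)%:R)); last by rewrite eq_sym.
  apply: le_trans (sum_good_le (F := fun x u z => px x * joint_uz u z) a_gt0 _ _).
  + rewrite exchange_big /=; apply: ler_sum => x' _.
    under eq_bigr do rewrite mulr_sumr.
    rewrite exchange_big; apply: ler_sum => u _ /=.
    under eq_bigr do rewrite [px _ * px _]mulrC -mulrA.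
    rewrite -mulr_sumr; under [leRHS]eq_bigr do rewrite -mulrA.
    by rewrite -mulr_sumr ler_wpM2l // sum_tilted_x.
  + by move=> x u z; rewrite mulr_ge0 // joint_uz_ge0.
  + by move=> x u z /andP[].
- have -> : M.-1%:R * K.-1%:R / b =
      \sum_(m' : 'I_M | m' != m) \sum_(l' : 'I_K | l' != l) b^-1.
    rewrite !sumr_const -mulrA mulr_natl mulr_natl; congr (_ *+ _ *+ _).
    - by have := cardC1 l; rewrite card_ord => <-; apply: eq_card.
    - by have := cardC1 m; rewrite card_ord => <-; apply: eq_card.
  rewrite avg_sum; apply: ler_sum => m' mm'; rewrite avg_sum; apply: ler_sum => l' ll'.
  rewrite [avg (t3 m' l')](avg_marg22 (fun x x' u u' => \sum_z tilted x u z * (good x' u' z)%:R));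
    [|by rewrite eq_sym..].
  apply: le_trans (sum_good_le (F := fun x u z => px x * marg_u u * marg_z z) b_gt0 _ _).
  + rewrite exchange_big /=; apply: ler_sum => x' _.
    under eq_bigr do rewrite exchange_big mulr_sumr.
    rewrite exchange_big; apply: ler_sum => u' _ /=.
    apply: (@le_trans _ _ (px x' * marg_u u' *
        \sum_u \sum_x px x * (marg_u u * \sum_z tilted x u z * (good x' u' z)%:R))).
      rewrite [X in _ <= _ * X]exchange_big mulr_sumr /=; apply: ler_sum => x _.
      rewrite mulr_sumr [leRHS]mulr_sumr; apply: ler_sum => u _.
      by rewrite le_eqVlt; apply/orP; left; apply/eqP; ring.
    under [leRHS]eq_bigr do rewrite -mulrA.
    rewrite -mulr_sumr ler_wpM2l ?mulr_ge0 //.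
    have h u := @sum_tilted_x (fun z => (good x' u' z)%:R) u (fun z => ler0n _ _).
    apply: le_trans (ler_sum _ (fun u _ => h u)) _.
    by rewrite exchange_big /=; under eq_bigr do rewrite -mulr_suml.
  + by move=> x u z; rewrite !mulr_ge0 // sumr_ge0 // => u' _; rewrite joint_uz_ge0.
  + by move=> x u z /andP[].
Qed.

End Packing.
Lemma mean_le (n : nat) (F : 'I_n -> R) (B : R) :
  (0 < n)%N -> (forall i, F i <= B) -> n%:R^-1 * \sum_i F i <= B.
Proof.
move=> n0 le; rewrite mulrC ler_pdivrMr ?ltr0n //.
apply: le_trans (ler_sum _ (fun i _ => le i)) _.
by rewrite sumr_const card_ord mulr_natr.
Qed.

Lemma miss_le a b : miss a b <=
  \sum_x \sum_u \sum_y \sum_z joint x u y z *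
    (joint_xuz x u z < a * (px x * joint_uz u z))%R%:R +
  \sum_x \sum_u \sum_y \sum_z joint x u y z *
    (joint_xuz x u z < b * (px x * marg_u u * marg_z z))%R%:R.
Proof.
rewrite -big_split; apply: ler_sum => x _; rewrite -big_split; apply: ler_sum => u _ /=.
rewrite -big_split /=; under [leRHS]eq_bigr do rewrite -big_split /=.
rewrite exchange_big /=; apply: ler_sum => z _; rewrite mulr_suml; apply: ler_sum => y _.
rewrite -mulrDr ler_wpM2l ?joint_ge0 // /good negb_and -!ltNge.
by case: (_ < _)%R; case: (_ < _)%R => /=; rewrite ?addr0 ?add0r ?lerDl.
Qed.

(* For each [y] the relay takes the index minimising the conditional error; this is
   at least as good as drawing it with probability proportional to [lratio]. *)
Lemma one_shot M K (a b T : R) : (0 < M)%N -> (0 < K)%N -> 0 < a -> 0 < b -> 0 <= T ->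
  exists (e : {ffun 'I_M -> X}) (c : {ffun 'I_K -> U}) (lam : Y -> 'I_K)
         (d : Z -> option 'I_M),
  M%:R^-1 * \sum_m \sum_y \sum_z
     W (e m) y * V (e m) y (c (lam y)) z * (d z != Some m)%:R
  <= 8 * T / K%:R +
     8 * (\sum_x \sum_u \sum_y \sum_z joint x u y z * (T * marg_u u < pu y u)%R%:R) +
     2 * (miss a b + M.-1%:R / a + M.-1%:R * K.-1%:R / b).
Proof.
move=> M0 K0 a0 b0 T0.
have MR : 0 < M%:R^-1 :> R by rewrite invr_gt0 ltr0n.
have KR : 0 < K%:R^-1 :> R by rewrite invr_gt0 ltr0n.
pose G (e : {ffun 'I_M -> X}) (c : {ffun 'I_K -> U}) y l : R := M%:R^-1 * \sum_(m : 'I_M) W (e m) y *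
  \sum_z V (e m) y (c l) z * (decoder a b e c z != Some m)%:R.
pose lam e c y := [arg min_(l < Ordinal K0) G e c y l]%O.
pose err (e : {ffun 'I_M -> X}) c := \sum_y G e c y (lam e c y).
suff /avg_exists[e [c le]] : avg err <= 8 * T / K%:R +
     8 * (\sum_x \sum_u \sum_y \sum_z joint x u y z * (T * marg_u u < pu y u)%R%:R) +
     2 * (miss a b + M.-1%:R / a + M.-1%:R * K.-1%:R / b).
  exists e, c, (lam e c), (decoder a b e c); apply: le_trans le.
  rewrite /err /G -mulr_sumr exchange_big /= le_eqVlt; apply/orP; left; apply/eqP.
  congr (_ * _); apply: eq_bigr => y _; apply: eq_bigr => m _; rewrite mulr_sumr.
  by apply: eq_bigr => z _; rewrite mulrA.
have G0 e c y l : 0 <= G e c y l.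
  apply: mulr_ge0; first exact: ltW.
  apply: sumr_ge0 => m _; apply: mulr_ge0; first by case: (W_chan (e m)).
  by apply: sumr_ge0 => z _; rewrite mulr_ge0 //; case: (V_chan (e m) y (c l)).
have G1 e c y l : G e c y l <= M%:R^-1 * \sum_m W (e m) y.
  rewrite ler_pM2l //; apply: ler_sum => m _.
  have [W0 _] := W_chan (e m); have [V0 V1] := V_chan (e m) y (c l).
  rewrite ler_piMr // -[leRHS]V1; apply: ler_sum => z _.
  rewrite -[leRHS]mulr1 ler_wpM2l //; by case: (_ != _).
have Gmin e c y l : G e c y (lam e c y) <= G e c y l.
  by rewrite /lam; case: arg_minP => // l' _ /(_ l isT).
(* If the total weight is at least 1/2, the minimum over indices is at most twice the weighted
   average. Otherwise the error is bounded by the probability of [y]. *)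
have relay e c y : G e c y (lam e c y) <=
    M%:R^-1 * (\sum_m W (e m) y) * (total_weight c y < 2^-1)%R%:R +
    2 * (K%:R^-1 * \sum_l lratio (c l) y * G e c y l).
  have S0 : 0 <= K%:R^-1 * \sum_l lratio (c l) y * G e c y l.
    apply: mulr_ge0; first exact: ltW.
    by apply: sumr_ge0 => l _; rewrite mulr_ge0 // lratio_ge0.
  case: ltP => [_|wt]; first by rewrite mulr1 -[leLHS]addr0 lerD // mulr_ge0.
  rewrite mulr0 add0r.
  have : total_weight c y * G e c y (lam e c y) <=
      K%:R^-1 * \sum_l lratio (c l) y * G e c y l.
    rewrite /total_weight -mulrA ler_pM2l // mulr_suml; apply: ler_sum => l _.
    by rewrite ler_wpM2l // lratio_ge0.
  have := G0 e c y (lam e c y); nra.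
(* Summing over [y] absorbs the likelihood ratio into [tilted]; the index [l] is now fixed
   independently of the codebook. *)
have {relay} errle e c : err e c <=
    (\sum_y M%:R^-1 * \sum_m W (e m) y * (total_weight c y < 2^-1)%R%:R) +
    2 * (K%:R^-1 * (M%:R^-1 * \sum_l \sum_m
      \sum_z tilted (e m) (c l) z * (decoder a b e c z != Some m)%:R)).
  apply: le_trans (ler_sum _ (fun y _ => relay e c y)) _; rewrite big_split /=.
  apply: lerD; first by apply: ler_sum => y _; rewrite -mulrA mulr_suml.
  rewrite -!mulr_sumr ler_pM2l // ler_pM2l //.
  rewrite exchange_big /= mulr_sumr; apply: ler_sum => l _.
  rewrite mulr_sumr; under eq_bigr do rewrite /G mulrCA mulr_sumr mulr_sumr.
  rewrite exchange_big /=; apply: ler_sum => m _.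
  rewrite -mulr_sumr ler_pM2l //.
  under [leLHS]eq_bigr do rewrite !mulr_sumr.
  rewrite exchange_big /=; apply: ler_sum => z _; rewrite mulr_suml; apply: ler_sum => y _.
  by rewrite !mulrA.
apply: le_trans (ler_avg errle) _.
rewrite avgD avgZ; apply: lerD.
  apply: le_trans (covering K0 T0).
  rewrite avg_sum; apply: ler_sum => y _; rewrite avgZ avg_sum.
  apply: mean_le => // m.
  rewrite /avg /marg_y -(prodpmf_marg1 m _ px_pmf) mulr_suml; apply: ler_sum => e _.
  rewrite -mulrA; under eq_bigr do rewrite mulrCA.
  by rewrite -mulr_sumr.
rewrite ler_pM2l // avgZ avgZ avg_sum mulr_sumr; apply: mean_le => // l.
rewrite avg_sum; apply: mean_le => // m.
exact: packing.
Qed.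
End OneShot.

(** * Block codes *)

Lemma sum_only (R : realType) (T : finType) (t0 : T) (F : T -> R) :
  (forall t, t != t0 -> F t = 0) -> \sum_t F t = F t0.
Proof. by move=> F0; rewrite (bigD1 t0) //= big1 ?addr0. Qed.

Section Positivity.
Variables (R : realType) (X U Y Z : finType).
Variables (px : X -> R) (W : X -> Y -> R) (pu : Y -> U -> R).
Variable V : X -> Y -> U -> Z -> R.
Hypotheses (px_pmf : is_pmf px) (W_chan : is_channel W).
Hypotheses (pu_chan : is_channel pu) (V_chan : forall x y, is_channel (V x y)).

(** Makes the logarithms in the information densities meaningful on the support: each quantity is a
    factor of a positive joint term or a sum of nonnegative terms containing it. *)
Lemma joint_pos x u y z : joint px W pu V x u y z != 0 ->
  [/\ 0 < px x, 0 < W x y, 0 < pu y u, 0 < V x y u z & 0 < joint_xuz px W pu V x u z]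
  /\ [/\ 0 < joint_uz px W pu V u z, 0 < marg_u px W pu V u & 0 < marg_z px W pu V z].
Proof.
move=> j0; have jp : 0 < joint px W pu V x u y z by rewrite lt_def j0 joint_ge0.
have xuz : 0 < joint_xuz px W pu V x u z.
  apply: lt_le_trans jp _; rewrite /joint_xuz (bigD1 y) //= lerDl sumr_ge0 // => *.
  exact: joint_ge0.
have uz : 0 < joint_uz px W pu V u z.
  apply: lt_le_trans xuz _; rewrite /joint_uz (bigD1 x) //= lerDl sumr_ge0 // => *.
  exact: joint_xuz_ge0.
have mu : 0 < marg_u px W pu V u.
  apply: lt_le_trans uz _; rewrite /marg_u (bigD1 z) //= lerDl sumr_ge0 // => *.
  exact: joint_uz_ge0.
have mz : 0 < marg_z px W pu V z.
  apply: lt_le_trans uz _; rewrite /marg_z (bigD1 u) //= lerDl sumr_ge0 // => *.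
  exact: joint_uz_ge0.
move: j0; rewrite /joint !mulf_eq0 !negb_or => /andP[/andP[/andP[h1 h2] h3] h4].
split; split=> //; rewrite lt_def ?h1 ?h2 ?h3 ?h4 /=.
- by case: px_pmf.
- by case: (W_chan x).
- by case: (pu_chan y).
- by case: (V_chan x y u).
Qed.

End Positivity.

Section NLetter.
Variables (R : realType) (X U Y Z : finType).
Variables (px : X -> R) (W : X -> Y -> R) (pu : Y -> U -> R).
Variable V : X -> Y -> U -> Z -> R.
Hypotheses (px_pmf : is_pmf px) (W_chan : is_channel W).
Hypotheses (pu_chan : is_channel pu) (V_chan : forall x y, is_channel (V x y)).

Definition prodchan (I A B : finType) (Q : A -> B -> R)
    (a : {ffun I -> A}) (b : {ffun I -> B}) : R :=
  \prod_i Q (a i) (b i).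

Lemma prodchan_is_channel (I A B : finType) (Q : A -> B -> R) :
  is_channel Q -> is_channel (@prodchan I A B Q).
Proof.
move=> Qc a; split=> [b|].
  by apply: prodr_ge0 => i _; case: (Qc (a i)).
rewrite (sum_prod_ffun (fun i => Q (a i))) big1 // => i _.
by case: (Qc (a i)).
Qed.

Variable I : finType.

Definition prodV (x : {ffun I -> X}) (y : {ffun I -> Y}) (u : {ffun I -> U})
    (z : {ffun I -> Z}) : R := \prod_i V (x i) (y i) (u i) (z i).

Lemma prodV_is_channel x y : is_channel (prodV x y).
Proof.
move=> u; split=> [z|].
  by apply: prodr_ge0 => i _; case: (V_chan (x i) (y i) (u i)).
rewrite (sum_prod_ffun (fun i => V (x i) (y i) (u i))) big1 // => i _.
by case: (V_chan (x i) (y i) (u i)).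
Qed.

Local Notation pxn := (@prodpmf R I X px).
Local Notation Wn := (@prodchan I X Y W).
Local Notation pun := (@prodchan I Y U pu).

(** This and the next lemmas factor the block law and its marginals over letters, which turns the
    one-shot thresholds into products suited to [aep]. *)
Lemma prod_joint x u y z :
  joint pxn Wn pun prodV x u y z = \prod_i joint px W pu V (x i) (u i) (y i) (z i).
Proof. by rewrite /joint !big_split. Qed.

Lemma prod_joint_xuz x u z :
  joint_xuz pxn Wn pun prodV x u z = \prod_i joint_xuz px W pu V (x i) (u i) (z i).
Proof.
rewrite -(sum_prod_ffun (fun i y => joint px W pu V (x i) (u i) y (z i))).
by apply: eq_bigr => y _; exact: prod_joint.
Qed.

Lemma prod_joint_uz u z :
  joint_uz pxn Wn pun prodV u z = \prod_i joint_uz px W pu V (u i) (z i).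
Proof.
rewrite -(sum_prod_ffun (fun i x => joint_xuz px W pu V x (u i) (z i))).
by apply: eq_bigr => y _; exact: prod_joint_xuz.
Qed.

Lemma prod_marg_u u : marg_u pxn Wn pun prodV u = \prod_i marg_u px W pu V (u i).
Proof.
rewrite -(sum_prod_ffun (fun i z => joint_uz px W pu V (u i) z)).
by apply: eq_bigr => y _; exact: prod_joint_uz.
Qed.

Lemma prod_marg_z z : marg_z pxn Wn pun prodV z = \prod_i marg_z px W pu V (z i).
Proof.
rewrite -(sum_prod_ffun (fun i u => joint_uz px W pu V u (z i))).
by apply: eq_bigr => y _; exact: prod_joint_uz.
Qed.

End NLetter.

Arguments prodV {R X U Y Z} V {I} x y u z.

(** Merges several sequences into one sequence over a product alphabet, the form in which [aep]
    applies. *)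
Lemma sum_ffun_pair (R : realType) (I A B : finType)
    (h : {ffun I -> A} -> {ffun I -> B} -> R) :
  \sum_a \sum_b h a b =
  \sum_(t : {ffun I -> A * B}) h [ffun i => (t i).1] [ffun i => (t i).2].
Proof.
rewrite pair_big /=.
pose f (t : {ffun I -> A * B}) : {ffun I -> A} * {ffun I -> B} := ([ffun i => (t i).1], [ffun i => (t i).2]).
rewrite (reindex f) //=.
exists (fun p : {ffun I -> A} * {ffun I -> B} => [ffun i => (p.1 i, p.2 i)]) => [t _|[a b] _].
  by apply/ffunP => i; rewrite !ffunE; case: (t i).
by congr (_, _); apply/ffunP => i; rewrite !ffunE.
Qed.

Section NLetterAep.
Variables (R : realType) (X U Y Z : finType).
Variables (px : X -> R) (W : X -> Y -> R) (pu : Y -> U -> R).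
Variable V : X -> Y -> U -> Z -> R.
Hypotheses (px_pmf : is_pmf px) (W_chan : is_channel W).
Hypotheses (pu_chan : is_channel pu) (V_chan : forall x y, is_channel (V x y)).

Lemma joint_aep (F G : X -> U -> Y -> Z -> R) (E d : R) :
    (forall x u y z, joint px W pu V x u y z != 0 -> 0 < F x u y z /\ 0 < G x u y z) ->
    E = \sum_x \sum_u \sum_y \sum_z
          joint px W pu V x u y z * (ln (F x u y z) - ln (G x u y z)) ->
    0 < d ->
  exists C, forall n : nat, n%:R *
    (\sum_(x : {ffun 'I_n -> X}) \sum_(u : {ffun 'I_n -> U})
     \sum_(y : {ffun 'I_n -> Y}) \sum_(z : {ffun 'I_n -> Z})
       joint (prodpmf px) (prodchan W) (prodchan pu) (prodV V) x u y z *
       (\prod_i F (x i) (u i) (y i) (z i)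
         < expR (n%:R * (E - d)) * \prod_i G (x i) (u i) (y i) (z i))%R%:R) <= C.
Proof.
move=> FG EE d0.
pose q (t : X * U * Y * Z) := joint px W pu V t.1.1.1 t.1.1.2 t.1.2 t.2.
pose F' (t : X * U * Y * Z) := F t.1.1.1 t.1.1.2 t.1.2 t.2.
pose G' (t : X * U * Y * Z) := G t.1.1.1 t.1.1.2 t.1.2 t.2.
have sum4 (h : X -> U -> Y -> Z -> R) : \sum_x \sum_u \sum_y \sum_z h x u y z =
    \sum_(t : X * U * Y * Z) h t.1.1.1 t.1.1.2 t.1.2 t.2.
  by rewrite pair_big /= pair_big /= pair_big.
have q_pmf : is_pmf q.
  split=> [t|]; first exact: joint_ge0.
  rewrite -(sum4 (joint px W pu V)) -(sum_joint_xuz px_pmf W_chan pu_chan V_chan).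
  by apply: eq_bigr => x _; apply: eq_bigr => u _; rewrite exchange_big.
have [C HC] := @aep R _ q F' G' E d q_pmf
  (fun t => FG t.1.1.1 t.1.1.2 t.1.2 t.2)
  (etrans EE (sum4 (fun x u y z =>
     joint px W pu V x u y z * (ln (F x u y z) - ln (G x u y z))))) d0.
exists C => n; apply: le_trans (HC n); rewrite le_eqVlt; apply/orP; left; apply/eqP.
congr (_ * _).
rewrite sum_ffun_pair (sum_ffun_pair (fun xu y => \sum_z _)).
rewrite (sum_ffun_pair (fun xuy z => joint (prodpmf px) (prodchan W) (prodchan pu)
   (prodV V) _ _ _ z * _)).
apply: eq_bigr => t _; rewrite prod_joint /prodpmf.
congr (_ * (nat_of_bool _)%:R); first by apply: eq_bigr => i _; rewrite !ffunE.
by congr (_ < _ * _); apply: eq_bigr => i _; rewrite !ffunE.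
Qed.

End NLetterAep.

(** The packing bound counts only [M - 1] wrong messages and [K - 1] wrong indices, so rounding up
    costs nothing there. *)
Lemma absz_ceil (R : realType) (x : R) : 0 < x ->
  [/\ (0 < `|Num.ceil x|)%N, x <= `|Num.ceil x|%N%:R & `|Num.ceil x|%N.-1%:R <= x].
Proof.
move=> x0; have c0 : (0 < Num.ceil x)%R by rewrite ceil_gt0.
have E : (`|Num.ceil x|%N%:R = (Num.ceil x)%:~R :> R).
  by rewrite -[in RHS](gtz0_abs c0).
have n0 : (0 < `|Num.ceil x|)%N by rewrite absz_gt0 gt_eqF.
split=> //; first by rewrite E ceil_ge.
rewrite -subn1 natrB // E lerBlDr ltW //.
by have := ceilB1_lt x; rewrite rmorphB /= ltrBlDr.
Qed.

(** Exponential decay is weakened to order [1/n], the rate that Chebyshev gives for the other error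
    terms. *)
Lemma natr_expRN_le (R : realType) (d : R) (n : nat) :
  0 < d -> n%:R * expR (- (n%:R * d)) <= d^-1.
Proof.
move=> d0; rewrite expRN ler_pdivrMr ?expR_gt0 // ler_pdivlMl //.
by rewrite mulrC; apply: le_trans (expR_ge1Dx _); rewrite lerDr.
Qed.

(** * Block codes with error of order 1/n at every rate below the bound *)

Section Achievability.
Variables (R : realType) (X1 X2 Y2 Y3 U : finType).
Variables (W2 : X1 -> Y2 -> R) (W3 : X1 -> X2 -> Y2 -> Y3 -> R).
Variables (px1 : X1 -> R) (pu : Y2 -> U -> R) (fx2 : U -> Y2 -> X2).
Hypotheses (HW2 : is_channel W2) (HW3 : forall x1 x2, is_channel (W3 x1 x2)).
Hypotheses (Hpx1 : is_pmf px1) (Hpu : is_channel pu).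

(** Substituting the relay function for the input [X2] leaves a channel from (x, y, u) to z, as the
    one-shot bound requires. *)
Let V x y u z : R := W3 x (fx2 u y) y z.
Local Notation jt := (joint px1 W2 pu V).
Local Notation jxuz := (joint_xuz px1 W2 pu V).
Local Notation juz := (joint_uz px1 W2 pu V).
Local Notation mu := (marg_u px1 W2 pu V).
Local Notation mz := (marg_z px1 W2 pu V).

Let HV x y : is_channel (V x y).
Proof. by move=> u; exact: HW3. Qed.

(* In nats: I(X1;U,Y3), I(X1,U;Y3) + I(X1;U) and I(U;Y2). *)
Definition info_x_uz : R := \sum_x \sum_u \sum_y \sum_z
  jt x u y z * (ln (jxuz x u z) - ln (px1 x * juz u z)).
Definition info_x_u_z : R := \sum_x \sum_u \sum_y \sum_z
  jt x u y z * (ln (jxuz x u z) - ln (px1 x * mu u * mz z)).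
Definition info_u_y : R := \sum_x \sum_u \sum_y \sum_z
  jt x u y z * (ln (pu y u) - ln (mu u)).

Lemma nletter_code (r d : R) : 0 < d ->
    r * ln 2 + 2 * d <= info_x_uz ->
    r * ln 2 + info_u_y + 4 * d <= info_x_u_z ->
  exists C, forall n, exists c : nc_code X1 X2 Y2 Y3 (nmsg r n) n,
    n%:R * nc_err W2 W3 c <= C.
Proof.
move=> d0 h1 h2.
have pos := joint_pos Hpx1 HW2 Hpu HV.
have [C1 HC1] : exists C, forall n : nat, n%:R *
    (\sum_(x : {ffun 'I_n -> X1}) \sum_(u : {ffun 'I_n -> U})
     \sum_(y : {ffun 'I_n -> Y2}) \sum_(z : {ffun 'I_n -> Y3})
       joint (prodpmf px1) (prodchan W2) (prodchan pu) (prodV V) x u y z *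
       (\prod_i jxuz (x i) (u i) (z i)
         < expR (n%:R * (info_x_uz - d)) * \prod_i (px1 (x i) * juz (u i) (z i)))%R%:R) <= C.
  apply: (joint_aep Hpx1 HW2 Hpu HV
    (F := fun x u _ z => jxuz x u z) (G := fun x u _ z => px1 x * juz u z)) => //.
  by move=> x u y z /pos[[? ? ? ? ?] [? ? ?]]; split=> //; rewrite mulr_gt0.
have [C2 HC2] : exists C, forall n : nat, n%:R *
    (\sum_(x : {ffun 'I_n -> X1}) \sum_(u : {ffun 'I_n -> U})
     \sum_(y : {ffun 'I_n -> Y2}) \sum_(z : {ffun 'I_n -> Y3})
       joint (prodpmf px1) (prodchan W2) (prodchan pu) (prodV V) x u y z *
       (\prod_i jxuz (x i) (u i) (z i)
         < expR (n%:R * (info_x_u_z - d)) *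
           \prod_i (px1 (x i) * mu (u i) * mz (z i)))%R%:R) <= C.
  apply: (joint_aep Hpx1 HW2 Hpu HV
    (F := fun x u _ z => jxuz x u z) (G := fun x u _ z => px1 x * mu u * mz z)) => //.
  by move=> x u y z /pos[[? ? ? ? ?] [? ? ?]]; split=> //; rewrite !mulr_gt0.
(* The equipartition bound with p(u) as numerator: the event says that p(u|y) exceeds p(u) by more
   than the factor [T] chosen below. *)
have [C3 HC3] : exists C, forall n : nat, n%:R *
    (\sum_(x : {ffun 'I_n -> X1}) \sum_(u : {ffun 'I_n -> U})
     \sum_(y : {ffun 'I_n -> Y2}) \sum_(z : {ffun 'I_n -> Y3})
       joint (prodpmf px1) (prodchan W2) (prodchan pu) (prodV V) x u y z *
       (\prod_i mu (u i)
         < expR (n%:R * (- info_u_y - d)) * \prod_i pu (y i) (u i))%R%:R) <= C.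
  apply: (joint_aep Hpx1 HW2 Hpu HV
    (F := fun _ u _ _ => mu u) (G := fun _ u y _ => pu y u)) => //.
    by move=> x u y z /pos[[? ? ? ? ?] [? ? ?]].
  rewrite /info_u_y -sumrN; apply: eq_bigr => x _; rewrite -sumrN; apply: eq_bigr => u _.
  rewrite -sumrN; apply: eq_bigr => y _; rewrite -sumrN; apply: eq_bigr => z _.
  by rewrite -mulrN opprB.
exists (8 * d^-1 + 8 * C3 + 2 * (C1 + C2 + d^-1 + d^-1)) => n.
(* The exponents of [a] and [b] sit [d] below the information densities. That of [T] sits [d] above
   I(U;Y2), and that of [K] another [d] higher. The margins [2 * d] and [4 * d] in the hypotheses
   then make [T / K] and both packing terms at most [expR (- (n * d))]. *)
pose a := expR (n%:R * (info_x_uz - d)).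
pose b := expR (n%:R * (info_x_u_z - d)).
pose T := expR (n%:R * (info_u_y + d)).
pose K := `|Num.ceil (expR (n%:R * (info_u_y + 2 * d)))|%N.
have [K0 Kge Kle] : [/\ (0 < K)%N, expR (n%:R * (info_u_y + 2 * d)) <= K%:R
    & K.-1%:R <= expR (n%:R * (info_u_y + 2 * d))] by apply: absz_ceil; exact: expR_gt0.
have [M0 _ Mle] : [/\ (0 < nmsg r n)%N, 2 `^ (n%:R * r) <= (nmsg r n)%:R
    & (nmsg r n).-1%:R <= 2 `^ (n%:R * r)] by apply: absz_ceil; rewrite powR_gt0.
have {}Mle : (nmsg r n).-1%:R <= expR (n%:R * (r * ln 2)).
  by apply: le_trans Mle _; rewrite /powR pnatr_eq0 /= mulrA.
have [e [c [lam [dec]]]] := one_shot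
  (prodpmf_is_pmf 'I_n Hpx1) (prodchan_is_channel (I := 'I_n) HW2)
  (prodchan_is_channel (I := 'I_n) Hpu) (@prodV_is_channel _ _ _ _ _ _ HV 'I_n)
  M0 K0 (expR_gt0 _ : 0 < a) (expR_gt0 _ : 0 < b) (expR_ge0 _ : 0 <= T).
set rhs := (X in _ <= X) => le.
(* Lookahead enters only through the index [lam y], chosen from the whole block; each symbol is then
   computed letter by letter. *)
exists (@NCCode X1 X2 Y2 Y3 (nmsg r n) n e (fun i y => fx2 (c (lam y) i) (y i)) dec).
have -> : nc_err W2 W3 (@NCCode X1 X2 Y2 Y3 (nmsg r n) n e
    (fun i y => fx2 (c (lam y) i) (y i)) dec) =
    (nmsg r n)%:R^-1 * \sum_m \sum_y \sum_z prodchan W2 (e m) y *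
      prodV V (e m) y (c (lam y)) z * (dec z != Some m)%:R.
  rewrite /nc_err /=; congr (_ * _); apply: eq_bigr => m _; apply: eq_bigr => y _.
  apply: eq_bigr => z _; rewrite /prodchan /prodV -big_split /=.
  by case: (dec z == _).
apply: le_trans (ler_wpM2l (ler0n _ n) le) _.
rewrite {le}/rhs.
have small x : x <= - d -> n%:R * expR (n%:R * x) <= d^-1.
  move=> xd; apply: le_trans (natr_expRN_le n d0); rewrite ler_wpM2l // ler_expR.
  by rewrite -mulrN ler_wpM2l.
have b1 : n%:R * (T / K%:R) <= d^-1.
  apply: (@le_trans _ _ (n%:R * expR (n%:R * - d))); last exact: small.
  rewrite ler_wpM2l // ler_pdivrMr ?ltr0n //.
  apply: le_trans (ler_wpM2l (expR_ge0 _) Kge); rewrite -expRD ler_expR.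
  by rewrite le_eqVlt; apply/orP; left; apply/eqP; ring.
have b2 : n%:R * ((nmsg r n).-1%:R / a) <= d^-1.
  apply: (@le_trans _ _ (n%:R * expR (n%:R * (r * ln 2 - (info_x_uz - d))))).
    rewrite ler_wpM2l // ler_pdivrMr ?expR_gt0 //; apply: le_trans Mle _.
    rewrite /a -expRD ler_expR le_eqVlt; apply/orP; left; apply/eqP; ring.
  by apply: small; lra.
have b3 : n%:R * ((nmsg r n).-1%:R * K.-1%:R / b) <= d^-1.
  apply: (@le_trans _ _ (n%:R *
      expR (n%:R * (r * ln 2 + (info_u_y + 2 * d) - (info_x_u_z - d))))).
    rewrite ler_wpM2l // ler_pdivrMr ?expR_gt0 //.
    apply: le_trans (ler_pM (ler0n _ _) (ler0n _ _) Mle Kle) _.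
    rewrite /b -!expRD ler_expR le_eqVlt; apply/orP; left; apply/eqP; ring.
  by apply: small; lra.
set p3 := (X in _ + 8 * X).
have b4 : n%:R * p3 <= C3.
  apply: le_trans (HC3 n); rewrite le_eqVlt; apply/orP; left; apply/eqP.
  rewrite /p3; congr (_ * _); apply: eq_bigr => x _; apply: eq_bigr => u _.
  apply: eq_bigr => y _; apply: eq_bigr => z _; congr (_ * (nat_of_bool _)%:R).
  rewrite prod_marg_u (_ : - info_u_y - d = - (info_u_y + d)) ?mulrN ?expRN; last by ring.
  by rewrite mulrC -ltr_pdivlMr ?expR_gt0 // [in RHS]mulrC.
set ms := miss _ _ _ _ _ _.
have b5 : n%:R * ms <= C1 + C2.
  apply: le_trans (ler_wpM2l (ler0n _ n) (miss_le
    (prodpmf_is_pmf 'I_n Hpx1) (prodchan_is_channel (I := 'I_n) HW2)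
    (prodchan_is_channel (I := 'I_n) Hpu) (@prodV_is_channel _ _ _ _ _ _ HV 'I_n) a b)) _.
  rewrite mulrDr; apply: lerD.
    apply: le_trans (HC1 n); rewrite le_eqVlt; apply/orP; left; apply/eqP.
    congr (_ * _); apply: eq_bigr => x _; apply: eq_bigr => u _.
    apply: eq_bigr => y _; apply: eq_bigr => z _; congr (_ * (nat_of_bool _)%:R).
    by rewrite prod_joint_xuz prod_joint_uz /prodpmf -big_split.
  apply: le_trans (HC2 n); rewrite le_eqVlt; apply/orP; left; apply/eqP.
  congr (_ * _); apply: eq_bigr => x _; apply: eq_bigr => u _.
  apply: eq_bigr => y _; apply: eq_bigr => z _; congr (_ * (nat_of_bool _)%:R).
  by rewrite prod_joint_xuz prod_marg_u prod_marg_z /prodpmf -!big_split.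
rewrite -(mulrA 8 T); lra.
Qed.

Lemma nc_err_ge0 M n (c : nc_code X1 X2 Y2 Y3 M n) : 0 <= nc_err W2 W3 c.
Proof.
apply: mulr_ge0; first by rewrite invr_ge0.
apply: sumr_ge0 => m _; apply: sumr_ge0 => y _; apply: sumr_ge0 => z _.
apply: mulr_ge0; last by case: ifP.
apply: prodr_ge0 => i _; apply: mulr_ge0; first by case: (HW2 (nc_enc c m i)).
by case: (HW3 (nc_enc c m i) (nc_relay c i y) (y i)).
Qed.

Lemma achievable_lt (r : R) :
  r * ln 2 < info_x_uz -> r * ln 2 < info_x_u_z - info_u_y ->
  nc_achievable W2 W3 r.
Proof.
move=> h1 h2.
(* A quarter of the smaller gap leaves room for both margins of [nletter_code]. *)
pose d := Order.min (info_x_uz - r * ln 2) (info_x_u_z - info_u_y - r * ln 2) / 4.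
have d0 : 0 < d by rewrite divr_gt0 // lt_min !subr_gt0 h1 h2.
have d1 : 4 * d <= info_x_uz - r * ln 2 by rewrite mulrC divfK // ge_min lexx.
have d2 : 4 * d <= info_x_u_z - info_u_y - r * ln 2.
  by rewrite mulrC divfK // ge_min lexx orbT.
have [||C HC] := @nletter_code r d d0; [lra..|].
pose c n := projT1 (cid (HC n)); have Hc n := projT2 (cid (HC n)); exists c.
(* [harmonic n] is [1 / (n + 1)], and [n + 1 <= 2 * n] once [n >= 1]; hence the factor 2. *)
apply: (@squeeze_cvgr _ _ _ _ (fun=> 0) (fun n => 2 * C * harmonic n)).
- near=> n; rewrite nc_err_ge0 /= ler_pdivlMr ?ltr0n //.
  have n1 : 1 <= n%:R :> R by rewrite ler1n; near: n; exists 1%N.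
  have := Hc n; have := nc_err_ge0 (c n); rewrite -natr1; nra.
- exact: cvg_cst.
- by have := cvgMl_tmp (a := 2 * C) (@cvg_harmonic R); rewrite mulr0; apply.
Unshelve. all: by end_near. Qed.

End Achievability.

(** * Entropies as expectations *)

Section InformationTerms.
Variables (R : realType) (X1 X2 Y2 Y3 U : finType).
Variables (W2 : X1 -> Y2 -> R) (W3 : X1 -> X2 -> Y2 -> Y3 -> R).
Variables (px1 : X1 -> R) (pu : Y2 -> U -> R) (fx2 : U -> Y2 -> X2).
Hypotheses (HW2 : is_channel W2) (HW3 : forall x1 x2, is_channel (W3 x1 x2)).
Hypotheses (Hpx1 : is_pmf px1) (Hpu : is_channel pu).

Let V x y u z : R := W3 x (fx2 u y) y z.
Local Notation jt := (joint px1 W2 pu V).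
Local Notation P := (relay_joint W2 W3 px1 pu fx2).
Local Notation Om := (X1 * U * Y2 * X2 * Y3)%type.

Let HV x y : is_channel (V x y).
Proof. by move=> u; exact: HW3. Qed.

(** The indicator pins [x2] to [fx2 u y], which reduces the five-variable law to [joint]. *)
Lemma sum_relay_joint (g : Om -> R) :
  \sum_t P t * g t =
  \sum_x \sum_u \sum_y \sum_z jt x u y z * g (x, u, y, fx2 u y, z).
Proof.
transitivity (\sum_x \sum_u \sum_y \sum_x2 \sum_z
    P (x, u, y, x2, z) * g (x, u, y, x2, z)).
  rewrite !pair_big /=; apply: eq_bigr.
  by case=> [[[[x u] y] x2] z].
apply: eq_bigr => x _; apply: eq_bigr => u _; apply: eq_bigr => y _.
rewrite (sum_only (t0 := fx2 u y)) => [|x2 /negbTE ne].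
  by apply: eq_bigr => z _; rewrite /= eqxx mulr1.
by apply: big1 => z _; rewrite /= ne mulr0 !mul0r.
Qed.

(** Grouping outcomes by the value of [f] writes every entropy as an expectation over the same
    space, so that entropies of different variables combine termwise. The factor [ln 2] converts
    bits to nats. *)
Lemma entropyE (A : finType) (f : Om -> A) :
  entropy P f * ln 2 = - \sum_t P t * ln (pushpmf P f (f t)).
Proof.
have l2 : ln 2 != 0 :> R by rewrite gt_eqF // ln_gt0 // ltr1n.
rewrite /entropy mulNr; congr (- _); rewrite mulr_suml.
rewrite (partition_big f xpredT) //=; apply: eq_bigr => a _.
transitivity (pushpmf P f a * ln (pushpmf P f a)).
  case: eqP => [->|_]; first by rewrite !mul0r.
  by rewrite /log2 -mulrA divfK.
by rewrite {1}/pushpmf mulr_suml; apply: eq_bigr => t /eqP->.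
Qed.

Lemma pushpmfE (A : finType) (f : Om -> A) a : pushpmf P f a =
  \sum_x \sum_u \sum_y \sum_z jt x u y z * (f (x, u, y, fx2 u y, z) == a)%:R.
Proof.
rewrite -(sum_relay_joint (fun t => (f t == a)%:R)) /pushpmf big_mkcond.
by apply: eq_bigr => t _; case: ifP; rewrite ?mulr1 ?mulr0.
Qed.

Local Notation vX1 := (fun t : Om => t.1.1.1.1).
Local Notation vU := (fun t : Om => t.1.1.1.2).
Local Notation vY2 := (fun t : Om => t.1.1.2).
Local Notation vY3 := (fun t : Om => t.2).

Ltac off := do ?[apply: big1 => ? _]; rewrite /= ?xpair_eqE;
  match goal with h : is_true (_ != _) |- _ => rewrite (negbTE h) ?andbF ?mulr0 end.

Lemma push_X1 x : pushpmf P vX1 x = px1 x.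
Proof.
rewrite pushpmfE (sum_only (t0 := x)) => [|x' ne]; last by off.
rewrite exchange_big /= -[RHS]mulr1 -[X in _ = _ * X](proj2 (HW2 x)) mulr_sumr; apply: eq_bigr => y _.
rewrite -[RHS]mulr1 -[X in _ = _ * X](proj2 (Hpu y)) mulr_sumr; apply: eq_bigr => u _.
rewrite -(joint_sumz _ _ _ HV); apply: eq_bigr => z _.
by rewrite eqxx mulr1.
Qed.

Lemma push_Y3 z : pushpmf P vY3 z = marg_z px1 W2 pu V z.
Proof.
rewrite pushpmfE exchange_big /=; apply: eq_bigr => u _; apply: eq_bigr => x _.
apply: eq_bigr => y _; rewrite (sum_only (t0 := z)) => [|z' ne]; last by off.
by rewrite eqxx mulr1.
Qed.

Lemma push_UY3 u z : pushpmf P (fun t => (vU t, vY3 t)) (u, z) = joint_uz px1 W2 pu V u z.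
Proof.
rewrite pushpmfE; apply: eq_bigr => x _.
rewrite (sum_only (t0 := u)) => [|u' ne]; last by off.
apply: eq_bigr => y _; rewrite (sum_only (t0 := z)) => [|z' ne]; last by off.
by rewrite eqxx mulr1.
Qed.

Lemma push_X1UY3 x u z :
  pushpmf P (fun t => (vX1 t, (vU t, vY3 t))) (x, (u, z)) = joint_xuz px1 W2 pu V x u z.
Proof.
rewrite pushpmfE (sum_only (t0 := x)) => [|x' ne]; last by off.
rewrite (sum_only (t0 := u)) => [|u' ne]; last by off.
apply: eq_bigr => y _; rewrite (sum_only (t0 := z)) => [|z' ne]; last by off.
by rewrite eqxx mulr1.
Qed.

Lemma push_X1_U_Y3 x u z :
  pushpmf P (fun t => ((vX1 t, vU t), vY3 t)) ((x, u), z) = joint_xuz px1 W2 pu V x u z.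
Proof.
rewrite -push_X1UY3; apply: eq_bigl => t.
by rewrite !xpair_eqE andbA.
Qed.

Lemma push_Y2X1 y x : pushpmf P (fun t => (vY2 t, vX1 t)) (y, x) = px1 x * W2 x y.
Proof.
rewrite pushpmfE (sum_only (t0 := x)) => [|x' ne]; last by off.
rewrite exchange_big (sum_only (t0 := y)) => [|y' ne]; last by off.
rewrite -[RHS]mulr1 -[X in _ = _ * X](proj2 (Hpu y)) mulr_sumr; apply: eq_bigr => u _.
rewrite -(joint_sumz _ _ _ HV); apply: eq_bigr => z _.
by rewrite eqxx mulr1.
Qed.

Lemma push_UY2X1 u y x :
  pushpmf P (fun t => (vU t, vY2 t, vX1 t)) (u, y, x) = px1 x * W2 x y * pu y u.
Proof.
rewrite pushpmfE (sum_only (t0 := x)) => [|x' ne]; last by off.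
rewrite (sum_only (t0 := u)) => [|u' ne]; last by off.
rewrite (sum_only (t0 := y)) => [|y' ne]; last by off.
rewrite -(joint_sumz _ _ _ HV); apply: eq_bigr => z _.
by rewrite eqxx mulr1.
Qed.

Lemma entropy_UX1 :
  entropy P (fun t => (vU t, vX1 t)) * ln 2 = entropy P (fun t => (vX1 t, vU t)) * ln 2.
Proof.
rewrite !entropyE; congr (- _); apply: eq_bigr => t _; congr (_ * ln _).
by apply: eq_bigl => t'; rewrite !xpair_eqE andbC.
Qed.

Lemma mutinfo_x_uz :
  mutinfo P vX1 (fun t => (vU t, vY3 t)) * ln 2 = info_x_uz W2 W3 px1 pu fx2.
Proof.
rewrite /mutinfo mulrBl mulrDl !entropyE !sum_relay_joint.
apply/eqP; rewrite -subr_eq0 /info_x_uz opprK; apply/eqP.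
rewrite -!sumrN -!big_split; apply: big1 => x _ /=.
rewrite -!sumrN -!big_split; apply: big1 => u _ /=.
rewrite -!sumrN -!big_split; apply: big1 => y _ /=.
rewrite -!sumrN -!big_split; apply: big1 => z _ /=.
rewrite push_X1 push_UY3 push_X1UY3.
have [->|/(joint_pos Hpx1 HW2 Hpu HV)[[? ? ? ? ?] [? ? ?]]] := eqVneq (jt x u y z) 0.
  by rewrite !mul0r !oppr0 !addr0.
rewrite lnM ?posrE //; ring.
Qed.

(** H(X1,U) cancels on the left and the logarithm of p(u) on the right. The Markov chain U - Y2 - X1
    enters through [push_UY2X1], where the law of the triple factors. *)
Lemma info_difference :
  (mutinfo P (fun t => (vX1 t, vU t)) vY3 - cond_mutinfo P vU vY2 vX1) * ln 2 =
  info_x_u_z W2 W3 px1 pu fx2 - info_u_y W2 W3 px1 pu fx2.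
Proof.
rewrite /mutinfo /cond_mutinfo.
set H1 := entropy P _; set H2 := entropy P _; set H3 := entropy P _.
set H4 := entropy P _; set H5 := entropy P _; set H6 := entropy P _.
set H7 := entropy P _.
have E : H4 * ln 2 = H1 * ln 2 by exact: entropy_UX1.
rewrite [LHS](_ : _ = H2 * ln 2 - H3 * ln 2 - H5 * ln 2 + H6 * ln 2 + H7 * ln 2
  + (H1 * ln 2 - H4 * ln 2)); last by ring.
rewrite E subrr addr0 /H2 /H3 /H5 /H6 /H7 !entropyE !sum_relay_joint.
apply/eqP; rewrite -subr_eq0 /info_x_u_z /info_u_y opprB !opprK; apply/eqP.
rewrite -!sumrN -!big_split; apply: big1 => x _ /=.
rewrite -!sumrN -!big_split; apply: big1 => u _ /=.
rewrite -!sumrN -!big_split; apply: big1 => y _ /=.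
rewrite -!sumrN -!big_split; apply: big1 => z _ /=.
rewrite push_X1 push_Y3 push_X1_U_Y3 push_Y2X1 push_UY2X1.
have [->|/(joint_pos Hpx1 HW2 Hpu HV)[[? ? ? ? ?] [? ? ?]]] := eqVneq (jt x u y z) 0.
  by rewrite !mul0r !oppr0 !addr0.
rewrite !lnM ?posrE ?mulr_gt0 //; ring.
Qed.

End InformationTerms.

(** * Passage to the supremum of achievable rates *)

Theorem theorem2 (R : realType) (X1 X2 Y2 Y3 : finType)
    (W2 : X1 -> Y2 -> R) (W3 : X1 -> X2 -> Y2 -> Y3 -> R)
    (HW2 : is_channel W2) (HW3 : forall x1 x2, is_channel (W3 x1 x2))
    (U : finType) (px1 : X1 -> R) (pu : Y2 -> U -> R) (fx2 : U -> Y2 -> X2)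
    (Hpx1 : is_pmf px1) (Hpu : is_channel pu) :
  let P := relay_joint W2 W3 px1 pu fx2 in
  let vX1 := fun t : X1 * U * Y2 * X2 * Y3 => t.1.1.1.1 in
  let vU := fun t : X1 * U * Y2 * X2 * Y3 => t.1.1.1.2 in
  let vY2 := fun t : X1 * U * Y2 * X2 * Y3 => t.1.1.2 in
  let vY3 := fun t : X1 * U * Y2 * X2 * Y3 => t.2 in
  ((Order.min (mutinfo P vX1 (fun t => (vU t, vY3 t)))
              (mutinfo P (fun t => (vX1 t, vU t)) vY3
               - cond_mutinfo P vU vY2 vX1))%:E
   <= nc_capacity W2 W3)%E.
Proof.
cbv zeta; set r0 := Order.min _ _.
have l2 : 0 < ln 2 :> R by rewrite ln_gt0 // ltr1n.
(* The coding argument needs slack, so it yields only rates strictly below [r0]; the supremum closes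
   the gap. *)
have below r : r < r0 -> (r%:E <= nc_capacity W2 W3)%E.
  rewrite lt_min => /andP[h1 h2].
  apply: ereal_sup_ubound; exists r => //.
  apply: (achievable_lt HW2 HW3 Hpx1 Hpu (fx2 := fx2)).
  - by rewrite -mutinfo_x_uz // ltr_pM2r.
  - by rewrite -info_difference // ltr_pM2r.
rewrite leNgt; apply/negP => lt.
(* A capacity below [r0] would be finite, being at least [r0 - 1], and the midpoint between it and
   [r0] would then exceed it while being achievable. *)
have := below (r0 - 1); rewrite ltrBlDr ltrDl ltr01 => /(_ isT).
case: (nc_capacity W2 W3) lt below => [s||] //= lt below _.
have := below ((s + r0) / 2); rewrite lte_fin in lt; rewrite lee_fin.
by move=> /(_ ltac:(lra)); lra.
Qed.
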